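(* Let $c_1,\dots,c_s$ be distinct integers, let $S=\{x^2+c_1,\dots,x^2+c_s\}$, and let $M_S$ be the semigroup generated by $S$ under composition. Assume that $S$ contains at least two polynomials that are irreducible in $\mathbb{Q}[x]$. Then there exist $N\geq 2$ and $\phi_i,\phi_j\in S$ such that every polynomial in the set $$\{\phi_i^N\circ\phi_j\circ\phi_i\circ F\,:\,F\in M_S\}$$ is irreducible in $\mathbb{Q}[x]$.
   Context: $M_S$ is the set of all polynomials of the form $\theta_1\circ\theta_2\circ\dots\circ\theta_n$ with $n\geq 1$ and $\theta_1,\dots,\theta_n\in S$. For a polynomial $\phi$, $\phi^N$ denotes the $N$-fold composition (iterate) $\phi\circ\dots\circ\phi$, not a power. *)

(* Defs.v *)
From mathcomp Require Import all_boot all_order all_algebra.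
Set Implicit Arguments.
Unset Strict Implicit.
Unset Printing Implicit Defensive.
Import GRing.Theory.
Local Open Scope ring_scope.

Definition quadratic_set (cs : seq int) : seq {poly rat} :=
  [seq 'X^2 + (c%:~R)%:P | c <- cs].

(* p \Po q is p(q(x)), so that comp_seq [:: t1; ...; tn] = t1 o ... o tn. *)
Definition comp_seq (ts : seq {poly rat}) : {poly rat} :=
  foldr (fun p q => p \Po q) 'X ts.

Definition comp_iter (N : nat) (p : {poly rat}) : {poly rat} :=
  iter N (fun q => p \Po q) 'X.

(* The words are nonempty: 'X itself is not put into the semigroup. *)
Definition in_comp_semigroup (S : seq {poly rat}) (F : {poly rat}) : Prop :=
  exists ts : seq {poly rat},
    [/\ (1 <= size ts)%N, {subset ts <= S} & F = comp_seq ts].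

(* Main.v *)
Require Import Defs.
From Stdlib Require Import Classical.
From mathcomp Require Import all_boot all_order all_algebra zify.
Set Implicit Arguments.
Unset Strict Implicit.
Unset Printing Implicit Defensive.
Import Order.TTheory GRing.Theory Num.Theory.
Local Open Scope ring_scope.

(** The theorem rests on one irreducibility test and on the dynamics of
    x^2 + c on the integers.

    The test ([irreducible_comp_quadratic]): if g is monic, irreducible and of
    even degree over a field, and g(c) is not a square, then g(x^2 + c) is
    irreducible.  After translating, c = 0; a factor r(x) of g(x^2) yields
    r(x) r(-x) = P(x^2) with P a divisor of g^2.  If the factorisation is
    nontrivial then P is proportional to g, and evaluating at 0 makes g(0) a
    square, since P(0) = r(0)^2.

    Composing on the right one quadratic at a time, every polynomial in the
    statement is irreducible as soon as phi_i^N(phi_j(z)) is never a square for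
    z = 0 and for z in phi_i(Z).  Write phi_i = x^2 + c and phi_j = x^2 + d;
    irreducibility says that -c and -d are not squares.  If c > 0, then
    phi_i^N(u) is never a square for N >= 2, because z^2 + c lies strictly
    between two consecutive squares when |z| >= c.  Let c = - a with a >= 2.
    A value z^2 - a that is a square forces |z| <= a, whereas an orbit leaving
    the interval [-(m+1), m+1], where m = floor (sqrt a), grows strictly; so if
    phi_i^N(u) is a square and N is large, the orbit of u starts inside the
    interval.  That leaves only a = m^2 + m, with the fixed points m + 1 and
    - m, and a = m^2 + m + 1, with the 2-cycle m, -(m+1).  For N even the
    square reached is then t^2 = m + 1, respectively t^2 = m, and u is t^2 or
    - t^2 ([square_iterate_cycle]).

    It remains to see that one of the two orders of c and d avoids such u.  If
    d > 0, the order that iterates x^2 + d works, so let d < 0 too.  Then z = 0 is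
    harmless, since neither d nor - d is t^2.  If u = phi_j(phi_i(y)) is t^2 or
    - t^2, where t comes from a = - c, then - d >= t^4 - 3 t^2 + 1
    ([parameter_lower_bound]), so if both orders fail, the two values of t agree
    ([parameter_le]).  As c and d are distinct, one is t^2 - t^4 and the other
    - (t^4 + t^2 + 1), and the order that iterates the former succeeds after all
    ([fixed_type_avoids_two_cycle_type]). *)

(** * Irreducibility of g(x^2 + c) *)

Section EvenNorm.
Variable F : fieldType.
Implicit Types p q g : {poly F}.

(** This is the norm of p from F[x] down to F[x^2], read as a polynomial in
    x^2: see [comp_even_norm]. *)
Definition even_norm p : {poly F} := even_poly p ^+ 2 - 'X * odd_poly p ^+ 2.

Lemma comp_X2_inj : injective (fun p => p \Po 'X^2).
Proof.
move=> p q /eqP; rewrite -subr_eq0 -comp_polyB comp_poly_eq0 ?size_polyXn //.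
by rewrite subr_eq0 => /eqP.
Qed.

Lemma comp_even_norm p : even_norm p \Po 'X^2 = p * (p \Po (- 'X)).
Proof.
have X2N : 'X^2 \Po (- 'X) = 'X^2 :> {poly F}.
  by rewrite comp_Xn_poly sqrrN.
set e := even_poly p \Po 'X^2; set o := odd_poly p \Po 'X^2.
have pE : p = e + o * 'X by rewrite poly_even_odd.
have pNE : p \Po (- 'X) = e - o * 'X.
  by rewrite {1}pE comp_polyD comp_polyM comp_polyX -!comp_polyA X2N mulrN.
have -> : p * (p \Po (- 'X)) = (e + o * 'X) * (e - o * 'X) by rewrite pNE -pE.
rewrite mulrC -subr_sqr /even_norm exprMn [o ^+ 2 * _]mulrC.
by rewrite comp_polyB !comp_polyM comp_polyX.
Qed.

Lemma even_normM p q : even_norm (p * q) = even_norm p * even_norm q.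
Proof.
apply: comp_X2_inj; rewrite /= comp_polyM !comp_even_norm comp_polyM.
by rewrite mulrACA.
Qed.

Lemma even_norm_X2 g : even_norm (g \Po 'X^2) = g * g.
Proof.
apply: comp_X2_inj; rewrite /= comp_polyM comp_even_norm -comp_polyA.
by rewrite comp_Xn_poly sqrrN.
Qed.

Lemma size_polyNX : size (- 'X : {poly F}) = 2.
Proof. by rewrite size_polyN size_polyX. Qed.

Lemma even_norm_eq0 p : (even_norm p == 0) = (p == 0).
Proof.
rewrite -(@comp_poly_eq0 _ (even_norm p) 'X^2) ?size_polyXn // comp_even_norm.
by rewrite mulf_eq0 comp_poly2_eq0 ?size_polyNX ?orbb.
Qed.

Lemma size_even_norm p : size (even_norm p) = size p.
Proof.
have [->|p0] := eqVneq p 0.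
  by apply/eqP; rewrite size_poly0 size_poly_eq0 even_norm_eq0.
have /(congr1 predn) : size (even_norm p \Po 'X^2) = (size p + size p).-1.
  by rewrite comp_even_norm size_mul ?comp_poly2_eq0 ?size_comp_poly2 ?size_polyNX.
rewrite size_comp_poly size_polyXn /= muln2 addnn.
have: even_norm p != 0 by rewrite even_norm_eq0.
rewrite -!size_poly_gt0 in p0 *.
case: (size p) p0 (size _) => // n _ [//|m] _ /=.
by move/double_inj->.
Qed.

Lemma lead_coef_even_norm p :
  odd (size p) -> lead_coef (even_norm p) = lead_coef p ^+ 2.
Proof.
move=> podd; have := congr1 lead_coef (comp_even_norm p).
rewrite lead_coef_comp ?size_polyXn // lead_coefXn expr1n mulr1 => ->.
rewrite lead_coefM lead_coef_comp ?size_polyNX // lead_coefN lead_coefX.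
case: (size p) podd => //= n; rewrite -signr_odd => /negbTE -> .
by rewrite mulr1.
Qed.

Lemma horner_even_norm0 p : (even_norm p).[0] = (even_poly p).[0] ^+ 2.
Proof. by rewrite /even_norm hornerD hornerN !hornerM hornerX mul0r subr0. Qed.

(** A factorisation g(x^2) = r q gives g^2 = N(r) N(q) for the norm N above.  As
    g is irreducible, one of N(r), N(q) is constant unless both are associates
    of g.  In the latter case the ratio is lead(r)^2, as r has even degree, and
    N(r)(0) is the square r(0)^2, so that g(0) would be a square. *)
Lemma irreducible_comp_X2 g :
    irreducible_poly g -> g \is monic -> odd (size g) ->
    (forall w, g.[0] <> w ^+ 2) ->
  irreducible_poly (g \Po 'X^2).
Proof.
move=> girr gmon godd g0; have gn0 := irredp_neq0 girr.
split.
  have := size_comp_poly g 'X^2; rewrite size_polyXn muln2.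
  case: (size g) girr.1 => [//|[//|n]] _ /=.
  by case: (size _) => [|[|]].
move=> q q1 /dvdpP [r hE].
have: g * g = even_norm r * even_norm q by rewrite -even_normM -hE even_norm_X2.
have [/dvdpP [R qE]|] := boolP (g %| even_norm q); last first.
  rewrite -irreducible_poly_coprime // coprimep_sym => cop E.
  have: even_norm q %| g * g by rewrite E dvdp_mull.
  rewrite Gauss_dvdpr // -(mulr1 g) Gauss_dvdpr // dvdp1 size_even_norm.
  by rewrite (negbTE q1).
rewrite qE mulrA => /(mulIf gn0) gE.
have rg : even_norm r %| g by rewrite gE dvdp_mulr.
(* Either r is constant, or N(r) is an associate of g. *)
have [r1|/eqpP[[k l] /= /andP[k0 l0] rE]] := irredp_XsubCP girr rg.
  have := r1; rewrite -size_poly_eq1 size_even_norm => /size_poly1P [c c0 rc].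
  by rewrite hE rc mul_polyC eqp_sym eqp_scale.
have rodd : odd (size r).
  rewrite -size_even_norm -(size_scale _ k0) rE size_scale //.
have := congr1 lead_coef rE; rewrite !lead_coefZ (monicP gmon) mulr1.
rewrite lead_coef_even_norm // => lE.
have := congr1 (horner^~ 0) rE; rewrite !hornerZ horner_even_norm0 -lE -mulrA.
move=> /(mulfI k0) E0; case: (g0 ((even_poly r).[0] / lead_coef r)).
rewrite expr_div_n E0 mulrC mulKf //.
by apply: contra_neq l0; rewrite -lE => ->; rewrite mulr0.
Qed.

Lemma irreducible_comp_XaddC g c :
  irreducible_poly g -> irreducible_poly (g \Po ('X + c%:P)).
Proof.
move=> girr.
have sz d : size ('X + d%:P : {poly F}) = 2 by rewrite size_XaddC.
have back d p : (p \Po ('X + d%:P)) \Po ('X + (- d)%:P) = p.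
  rewrite -comp_polyA comp_polyD comp_polyX comp_polyC polyCN subrK comp_polyXr //.
have back' p : (p \Po ('X + (- c)%:P)) \Po ('X + c%:P) = p.
  by have := back (- c) p; rewrite opprK.
split; first by rewrite size_comp_poly2 ?sz // girr.
move=> q q1 qd.
have /(dvdp_comp_poly ('X + (- c)%:P)) := qd; rewrite back.
move/(girr.2 _ _); rewrite size_comp_poly2 ?sz // => /(_ q1).
case/andP => /(dvdp_comp_poly ('X + c%:P)) + /(dvdp_comp_poly ('X + c%:P)).
rewrite back' => dvd_qg dvd_gq; exact/andP.
Qed.

Lemma irreducible_comp_quadratic g c :
    irreducible_poly g -> g \is monic -> odd (size g) ->
    (forall w, g.[c] <> w ^+ 2) ->
  irreducible_poly (g \Po ('X^2 + c%:P)).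
Proof.
move=> girr gmon godd gc.
have -> : 'X^2 + c%:P = ('X + c%:P) \Po 'X^2.
  by rewrite comp_polyD comp_polyX comp_polyC.
rewrite comp_polyA; apply: irreducible_comp_X2.
- exact: irreducible_comp_XaddC.
- by rewrite monicE lead_coef_comp ?size_XaddC // lead_coefXaddC expr1n mulr1.
- by rewrite size_comp_poly2 ?size_XaddC.
- by move=> w; rewrite horner_comp hornerD hornerX hornerC add0r; exact: gc.
Qed.
End EvenNorm.

(** * Orbits of x^2 + c on the integers *)

Definition quad (c x : int) : int := x ^+ 2 + c.
Definition nonsquare (n : int) := forall w : int, n <> w ^+ 2.

Lemma nonsquare_between (k n : int) :
  0 <= k -> k ^+ 2 < n -> n < (k + 1) ^+ 2 -> nonsquare n.
Proof.
move=> k0 kn nk w nE; move: kn nk; rewrite nE -(real_normK (num_real w)).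
rewrite !ltr_pXn2r ?nnegrE ?addr_ge0 //; lia.
Qed.

(** With y = |z| >= |c|, the value y^2 + c lies strictly between (y-1)^2 and
    (y+1)^2, and it is not y^2; moreover |z| >= |c| is preserved. *)
Lemma quad_outward (c z : int) : c != 0 -> c != - 1 -> `|c| <= `|z| ->
  `|c| <= `|quad c z| /\ nonsquare (quad c z).
Proof.
rewrite /quad -(real_normK (num_real z)); move: `|z| (normr_ge0 z) => y y0 c0 c1 cy.
split; first by nia.
have [cneg|cpos] := ltrP c 0.
  apply: (@nonsquare_between (y - 1)); nia.
apply: (@nonsquare_between y); nia.
Qed.

Lemma nonsquare_iter_outward (c z : int) (n : nat) : c != 0 -> c != - 1 ->
  `|c| <= `|z| -> nonsquare (iter n.+1 (quad c) z).
Proof.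
move=> c0 c1 cz; suff /(quad_outward c0 c1)[] : `|c| <= `|iter n (quad c) z| by [].
by elim: n => //= n /(quad_outward c0 c1)[].
Qed.

Lemma int_sqrt_floor (a : int) : 0 <= a ->
  exists m : int, [/\ 0 <= m, m ^+ 2 <= a & a < (m + 1) ^+ 2].
Proof.
case: a => // n _; elim: n => [|n [m [m0 lo hi]]]; first by exists 0.
have [lt|ge] := ltrP n.+1%:Z ((m + 1) ^+ 2).
  by exists m; split=> //; lia.
by exists (m + 1); split; nia.
Qed.

(** Outside the interval [-(m+1), m+1] one has a <= (|x| - 1)^2 - 1, hence
    x^2 - a >= 2 |x|: the orbit gains at least 1 at each step. *)
Lemma iter_quad_escape (a m x : int) (n : nat) : 0 <= m -> a < (m + 1) ^+ 2 ->
  m + 2 <= `|x| -> `|x| + n%:Z <= `|iter n (quad (- a)) x|.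
Proof.
move=> m0 am mx; elim: n => [|n IH] /=; first lia.
have : m + 2 <= `|iter n (quad (- a)) x| by lia.
rewrite /quad -[iter _ _ _ ^+ 2](real_normK (num_real _)).
by move: `|iter _ _ _| IH => y; nia.
Qed.

(** From (|z| - |w|) (|z| + |w|) = a > 0 one gets |z| + |w| <= a. *)
Lemma quad_square_bound (a z w : int) : 0 < a -> quad (- a) z = w ^+ 2 -> `|z| <= a.
Proof.
move=> a0; rewrite /quad -(real_normK (num_real z)) -(real_normK (num_real w)).
move: `|z| `|w| (normr_ge0 z) (normr_ge0 w) => y v y0 v0 E.
have [vy|yv] := ltrP v y; nia.
Qed.

(** Once outside [-(m+1), m+1], the orbit would exceed a in absolute value
    at step n - 1, which [quad_square_bound] forbids. *)
Lemma iter_quad_bound (a m u w : int) (k n : nat) :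
  0 < a -> 0 <= m -> a < (m + 1) ^+ 2 ->
  (k + `|a| < n)%N -> iter n (quad (- a)) u = w ^+ 2 ->
  `|iter k (quad (- a)) u| <= m + 1.
Proof.
move=> a0 m0 am kn; case: n kn => // n kn /= /(quad_square_bound a0) le_a.
rewrite leNgt; apply/negP => gt.
have := @iter_quad_escape a m (iter k (quad (- a)) u) (n - k) m0 am.
rewrite -iterD subnK; last lia.
lia.
Qed.

(** If |x| < m then x^2 - a <= - 2 m, which is within the bound only for m = 1,
    x = 0 and a = 2.  Apart from that case both |x| and |x^2 - a| are m or m + 1,
    and solving for a gives the two families. *)
Lemma bounded_orbit_shape (a m x : int) : 1 < a -> m ^+ 2 < a -> a < (m + 1) ^+ 2 ->
  0 <= m -> (forall k, (k <= 2)%N -> `|iter k (quad (- a)) x| <= m + 1) ->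
  a = 2 \/ (a = m ^+ 2 + m \/ a = m ^+ 2 + m + 1) /\ (`|x| = m \/ `|x| = m + 1).
Proof.
move=> a1 lo hi m0 bd.
have m1 : 1 <= m by nia.
have := bd 0%N isT; have := bd 1%N isT; have := bd 2 isT; rewrite /= /quad => {bd}.
rewrite -(real_normK (num_real (x ^+ 2 - a))) -(real_normK (num_real x)).
move: `|x| (normr_ge0 x) => y y0; set v := y ^+ 2 - a.
have vE : y ^+ 2 = v + a by rewrite /v; lia.
have [z zE] : exists z, z = `|v| by exists `|v|.
rewrite -zE; clearbody v => b2 b1 b0.
have [ym|ym] := ltrP y m.
  have : y ^+ 2 <= (m - 1) ^+ 2 by rewrite ler_pXn2r ?nnegrE //; lia.
  move=> yb; left.
  have m_1 : m = 1 by nia.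
  have y_0 : y = 0 by lia.
  by subst m y; lia.
have [zm|zm] := ltrP z m.
  have : z ^+ 2 <= (m - 1) ^+ 2 by rewrite ler_pXn2r ?nnegrE //; lia.
  move=> zb.
  have m_1 : m = 1 by nia.
  have y_0 : y = 1 \/ y = 2 by lia.
  subst m; case: y_0 => ?; subst y; lia.
right.
have [yE|yE] : y = m \/ y = m + 1 by lia.
  by subst y; split; [lia|left].
by subst y; split; [nia|right].
Qed.

Lemma iter_double_fix (T : Type) (f : T -> T) (x : T) (k : nat) :
  f (f x) = x -> iter k.*2 f x = x.
Proof. by move=> fx; elim: k => //= k ->. Qed.

(** The integers a for which x^2 - a has t^2 as a periodic point: in the first
    case t^2 is fixed, in the second t^2 and - (t^2 + 1) form a 2-cycle. *)
Definition square_cycle (a t : int) :=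
  a = (t ^+ 2) ^+ 2 - t ^+ 2 \/ a = (t ^+ 2) ^+ 2 + t ^+ 2 + 1.

(** The even number of iterations matters in the 2-cycle case: it brings u
    back to the square t^2 only from t^2 or - t^2, and not from the other point
    of the cycle. *)
Lemma square_iterate_cycle (a u w : int) (k : nat) : nonsquare a -> 1 < a ->
  (`|a| + 2 < k.*2)%N -> iter k.*2 (quad (- a)) u = w ^+ 2 ->
  exists t : int, [/\ 0 <= t, `|u| = t ^+ 2 & square_cycle a t].
Proof.
move=> nsq a1 ak itE.
have [m [m0 lo hi]] : exists m : int, [/\ 0 <= m, m ^+ 2 < a & a < (m + 1) ^+ 2].
  have [|m [m0 lo hi]] := @int_sqrt_floor a; first lia.
  by exists m; split=> //; rewrite lt_neqAle lo andbT eq_sym; apply/eqP/nsq.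
have bd j : (j <= 2)%N -> `|iter j (quad (- a)) u| <= m + 1.
  by move=> j2; apply: (iter_quad_bound _ m0 hi _ itE); lia.
exists `|w|; rewrite /square_cycle real_normK ?num_real //.
have [a2|[aE uE]] := bounded_orbit_shape a1 lo hi m0 bd.
  (* z^2 - 2 is never a square, by reduction modulo 4. *)
  case: k ak itE => // k _; rewrite doubleS iterS /quad a2 => E; exfalso.
  move: (iter _ _ _) E => z E.
  have [j zE] : exists j, z = 2 * j \/ z = 2 * j + 1.
    by exists (z %/ 2)%Z; lia.
  have [i wE] : exists i, w = 2 * i \/ w = 2 * i + 1.
    by exists (w %/ 2)%Z; lia.
  by case: zE wE E => -> [] ->; lia.
have sqpos : 0 <= w ^+ 2 := sqr_ge0 w.
have u2 : u ^+ 2 = `|u| ^+ 2 by rewrite real_normK ?num_real.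
case: k ak itE => // k _.
(* If a = m^2 + m, then u is sent to one of the fixed points - m and m + 1. *)
case: aE => aE.
  rewrite doubleS iterSr.
  have [uE1|uE1] := uE.
    have -> : quad (- a) u = - m by rewrite /quad u2 uE1; lia.
    rewrite iter_fix; last by rewrite /quad; lia.
    by move=> E; split=> //; nia.
  have -> : quad (- a) u = m + 1 by rewrite /quad u2 uE1; lia.
  rewrite iter_fix; last by rewrite /quad; lia.
  by move=> <-; split=> //; left; lia.
(* If a = m^2 + m + 1, then u is sent into the 2-cycle m, - (m + 1). *)
rewrite doubleS !iterSr.
have [uE1|uE1] := uE.
  have -> : quad (- a) u = - (m + 1) by rewrite /quad u2 uE1; lia.
  have mE : quad (- a) (- (m + 1)) = m by rewrite /quad; lia.
  have mE' : quad (- a) m = - (m + 1) by rewrite /quad; lia.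
  rewrite mE iter_double_fix ?mE' // => <-.
  by split=> //; right.
have -> : quad (- a) u = m by rewrite /quad u2 uE1; lia.
have mE : quad (- a) (- (m + 1)) = m by rewrite /quad; lia.
have mE' : quad (- a) m = - (m + 1) by rewrite /quad; lia.
rewrite mE' iter_double_fix ?mE //; lia.
Qed.

(** * One of the two orders is good *)

(** Put T = t^2.  The square root of a lies strictly between T - 1 and T in the
    first case, and between T and T + 1 in the second, so that no square is close
    to a: |y^2 - a| >= T - 1, while (y^2 - a)^2 is b + T or b - T. *)
Lemma parameter_lower_bound (a b t y : int) : 1 < a ->
  square_cycle a t -> `|quad (- b) (quad (- a) y)| = t ^+ 2 ->
  (t ^+ 2) ^+ 2 - 3 * t ^+ 2 + 1 <= b.
Proof.
rewrite /square_cycle /quad; move: (t ^+ 2) (sqr_ge0 t) => T T0 a1 aE E.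
rewrite -(real_normK (num_real y)) in E.
move: `|y| (normr_ge0 y) E => x x0.
have [z zE] : exists z, z = `|x ^+ 2 - a| by exists `|x ^+ 2 - a|.
rewrite -(real_normK (num_real (x ^+ 2 - a))) -zE => E.
suff zT : T - 1 <= z.
  have T2 : 1 <= T by case: aE; nia.
  have : (T - 1) ^+ 2 <= z ^+ 2 by rewrite ler_pXn2r ?nnegrE //; lia.
  lia.
have [xT|xT] := ltrP x T.
  have : x ^+ 2 <= (T - 1) ^+ 2 by rewrite ler_pXn2r ?nnegrE //; lia.
  by case: aE => aE; lia.
have [xT1|xT1] := ltrP T x; last first.
  have xE : x = T by lia.
  subst x.
  by case: aE => aE; lia.
have : (T + 1) ^+ 2 <= x ^+ 2 by rewrite ler_pXn2r ?nnegrE //; lia.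
by case: aE => aE; lia.
Qed.

(** If r > t then r^2 >= t^2 + 3, and the lower bound r^4 - 3 r^2 + 1 on a
    exceeds t^4 + t^2 + 1, the largest value that a can take. *)
Lemma parameter_le (a b t r x : int) : 1 < a -> 1 < b -> 0 <= t -> 0 <= r ->
  square_cycle a t -> square_cycle b r ->
  `|quad (- a) (quad (- b) x)| = r ^+ 2 -> r <= t.
Proof.
move=> a1 b1 t0 r0 aE bE E; have := parameter_lower_bound b1 bE E.
rewrite leNgt => low; apply/negP => tr.
have R : t ^+ 2 + 2 * t + 1 <= r ^+ 2 by nia.
have t1 : 1 <= t by case: aE; nia.
have T0 : 0 <= t ^+ 2 := sqr_ge0 t.
have TR : (t ^+ 2 + 3) * t ^+ 2 <= r ^+ 2 * (r ^+ 2 - 3) by apply: ler_pM; lia.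
by case: aE; lia.
Qed.

(** With z = x^2 - (T^2 - T), the equality would give z^2 = T^2 + 1, which is not
    a square, or z = T + 1 or z = - (T + 1); then x^2 = T^2 + 1 or
    x^2 = (T - 1)^2 - 2. *)
Lemma fixed_type_avoids_two_cycle_type (T x : int) : 1 < T ->
  `|quad (- (T ^+ 2 + T + 1)) (quad (- (T ^+ 2 - T)) x)| <> T.
Proof.
move=> T1; rewrite /quad; set z := x ^+ 2 - _ => E.
have {E} [zE|zE] : z ^+ 2 = T ^+ 2 + 1 \/ z ^+ 2 = (T + 1) ^+ 2 by lia.
  by apply: (@nonsquare_between T (T ^+ 2 + 1) _ _ _ z); lia.
move/eqP: zE; rewrite eqf_sqr => /orP[] /eqP; rewrite /z => zE.
  by apply: (@nonsquare_between T (T ^+ 2 + 1) _ _ _ x); lia.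
have [T2|T2] := ltrP 2 T; last by have := sqr_ge0 x; nia.
by apply: (@nonsquare_between (T - 2) (T ^+ 2 - 2 * T - 1) _ _ _ x); lia.
Qed.

(** The values z = quad c y arise from evaluating the polynomials of the theorem
    at integers; z = 0 arises when phi_j is composed with phi_i^N, where the test
    asks about the value of phi_i^N at the constant term of phi_j. *)
Definition hits_square (c d : int) (n : nat) :=
  exists z w : int, (z = 0 \/ exists y, z = quad c y) /\
    iter n (quad c) (quad d z) = w ^+ 2.

Lemma nonsquareN_neq (c : int) : nonsquare (- c) -> c != 0 /\ c != - 1.
Proof.
by move=> nsq; split; apply/eqP => cE; [apply: (nsq 0)|apply: (nsq 1)]; rewrite cE.
Qed.

(** For c > 0 every value of quad c is at least c, hence in the region of
    [nonsquare_iter_outward]. *)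
Lemma hits_square_neg (c d : int) (k : nat) :
  nonsquare (- c) -> (0 < k)%N -> hits_square c d k.*2 -> 1 < - c.
Proof.
move=> nsqc; case: k => // k _ [z [w [_ itE]]].
have [c0 c1] := nonsquareN_neq nsqc.
have [cpos|cneg] := ltrP 0 c; last lia.
move: itE; rewrite doubleS iterSr => itE.
have out : `|c| <= `|quad c (quad d z)|.
  by rewrite /quad; have := sqr_ge0 (z ^+ 2 + d); lia.
by case: (nonsquare_iter_outward c0 c1 out itE).
Qed.

Lemma hits_square_shape (c d : int) (k : nat) :
    nonsquare (- c) -> nonsquare (- d) -> 1 < - c -> 1 < - d ->
    (`|c| + 2 < k.*2)%N -> hits_square c d k.*2 ->
  exists t y : int, [/\ 0 <= t, square_cycle (- c) t &
    `|quad d (quad c y)| = t ^+ 2].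
Proof.
move=> nsqc nsqd a1 b1 ck [z [w [zE itE]]].
have itE' : iter k.*2 (quad (- - c)) (quad d z) = w ^+ 2 by rewrite opprK.
have [|t [t0 uE aE]] := square_iterate_cycle nsqc a1 _ itE'; first by lia.
case: zE => [z0|[y zE]]; last by exists t, y; rewrite -zE.
by move: uE; rewrite z0 /quad expr0n add0r => dE; have := nsqd t; lia.
Qed.

Lemma hits_square_asym (c d : int) (k : nat) :
    nonsquare (- c) -> nonsquare (- d) -> c != d ->
    (`|c| + `|d| + 2 < k.*2)%N ->
    hits_square c d k.*2 -> ~ hits_square d c k.*2.
Proof.
move=> nsqc nsqd cd k_gt hc hd.
have a1 : 1 < - c by apply: (hits_square_neg nsqc _ hc); lia.
have b1 : 1 < - d by apply: (hits_square_neg nsqd _ hd); lia.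
have [|t [y [t0 aE tE]]] := hits_square_shape nsqc nsqd a1 b1 _ hc; first by lia.
have [|r [x [r0 bE rE]]] := hits_square_shape nsqd nsqc b1 a1 _ hd; first by lia.
have rt : r <= t.
  by apply: (parameter_le a1 b1 t0 r0 aE bE (x := x)); rewrite !opprK.
have tr : t <= r.
  by apply: (parameter_le b1 a1 r0 t0 bE aE (x := y)); rewrite !opprK.
have rE' : r = t by lia.
subst r.
have T_gt (T : int) : 0 <= T -> 1 < T ^+ 2 - T -> 1 < T
  by move=> T0; have [//|T1] := ltrP 1 T; have [->|->] : T = 0 \/ T = 1 by lia.
have T0 : 0 <= t ^+ 2 := sqr_ge0 t.
case: aE bE => aE [] bE; [lia| | |lia].
  apply: (@fixed_type_avoids_two_cycle_type (t ^+ 2) y).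
    by apply: T_gt => //; lia.
  by rewrite -aE -bE !opprK.
apply: (@fixed_type_avoids_two_cycle_type (t ^+ 2) x).
  by apply: T_gt => //; lia.
by rewrite -aE -bE !opprK.
Qed.

Lemma exists_square_free_order (c d : int) :
    nonsquare (- c) -> nonsquare (- d) -> c != d ->
  exists k : nat, (1 < k.*2)%N /\ (~ hits_square c d k.*2 \/ ~ hits_square d c k.*2).
Proof.
move=> nsqc nsqd cd; exists (`|c| + `|d| + 3)%N; split; first lia.
have [hc|] := classic (hits_square c d (`|c| + `|d| + 3).*2); last by left.
by right; apply: hits_square_asym nsqc nsqd cd _ hc; lia.
Qed.

(** * From nonsquare values to irreducible compositions *)

Definition quad_poly (c : int) : {poly rat} := 'X^2 + (c%:~R)%:P.

Lemma size_quad_poly c : size (quad_poly c) = 3.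
Proof. exact: size_XnaddC. Qed.

Lemma monic_quad_poly c : quad_poly c \is monic.
Proof. by rewrite monicE lead_coefXnaddC. Qed.

Lemma horner_quad_poly c (x : int) : (quad_poly c).[x%:~R] = (quad c x)%:~R.
Proof. by rewrite hornerD hornerXn hornerC rmorphD rmorphXn. Qed.

(** An integer that is a square in Q is a square in Z: the squared denominator
    divides the squared numerator, and the two are coprime. *)
Lemma nonsquare_rat (n : int) (w : rat) : nonsquare n -> n%:~R <> w ^+ 2.
Proof.
move=> nsq nE; have dn0 : (denq w)%:~R != 0 :> rat by rewrite intr_eq0 denq_neq0.
have E : n * denq w ^+ 2 = numq w ^+ 2.
  apply: (@intr_inj rat); rewrite rmorphM !rmorphXn /= nE -exprMn.
  by congr (_ ^+ 2); rewrite -{1}(divq_num_den w) divfK.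
suff den1 : denq w = 1 by apply: (nsq (numq w)); rewrite -E den1 expr1n mulr1.
have : (`|denq w| %| `|numq w| ^ 2)%N.
  by apply/dvdnP; exists (`|n| * `|denq w|)%N; rewrite -mulnA -abszX -E abszM abszX.
rewrite -[(_ ^ 2)%N]muln1 Gauss_dvdr; last first.
  by rewrite coprime_sym coprimeXl ?coprime_num_den.
by rewrite dvdn1 => /eqP; have := denq_gt0 w; lia.
Qed.

Lemma irreducible_quad_poly_nonsquare c :
  irreducible_poly (quad_poly c) -> nonsquare (- c).
Proof.
move=> [_ irr] w cE; have := irr ('X - (w%:~R)%:P); rewrite size_XsubC.
rewrite dvdp_XsubCl /root horner_quad_poly /quad -cE addNr eqxx => /(_ isT isT).
by move/eqp_size; rewrite size_XsubC size_quad_poly.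
Qed.

Lemma comp_iterSr n p : comp_iter n.+1 p = comp_iter n p \Po p.
Proof.
elim: n => [|n IH]; first by rewrite /comp_iter /= comp_polyX comp_polyXr.
by rewrite -[LHS]/(p \Po comp_iter n.+1 p) {1}IH comp_polyA.
Qed.

Lemma horner_comp_iter c n (x : int) :
  (comp_iter n (quad_poly c)).[x%:~R] = (iter n (quad c) x)%:~R.
Proof.
elim: n => [|n IH]; first by rewrite hornerX.
by rewrite /comp_iter iterS horner_comp IH horner_quad_poly.
Qed.

Definition even_monic_irreducible (g : {poly rat}) :=
  [/\ irreducible_poly g, g \is monic & odd (size g)].

Lemma even_monic_irreducible_comp g c :
    even_monic_irreducible g -> (forall w, g.[c%:~R] <> w ^+ 2) ->
  even_monic_irreducible (g \Po quad_poly c).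
Proof.
move=> [girr gmon godd] gc; have irr := irreducible_comp_quadratic girr gmon godd gc.
split=> //.
  rewrite monicE lead_coef_comp ?size_quad_poly //.
  by rewrite !(monicP _) ?monic_quad_poly // expr1n mulr1.
have := size_comp_poly g (quad_poly c); rewrite size_quad_poly muln2 /=.
by case: (size _) irr.1 => //= n _ ->; rewrite odd_double.
Qed.

(** The orbit of the critical point 0 after one step, c, already lies in the
    outward region, so none of its later points is a square. *)
Lemma even_monic_irreducible_iter c n : irreducible_poly (quad_poly c) ->
  even_monic_irreducible (comp_iter n.+1 (quad_poly c)).
Proof.
move=> irr; have nsq := irreducible_quad_poly_nonsquare irr.
have [c0 c1] := nonsquareN_neq nsq.
elim: n => [|n IH].
  by rewrite /comp_iter /= comp_polyXr; split; rewrite ?monic_quad_poly ?size_quad_poly.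
rewrite comp_iterSr; apply: even_monic_irreducible_comp => // w.
by rewrite horner_comp_iter; apply/nonsquare_rat/nonsquare_iter_outward.
Qed.

Lemma comp_seq_rcons ts t : comp_seq (rcons ts t) = comp_seq ts \Po t.
Proof.
elim: ts => [|u ts IH] /=; first by rewrite comp_polyXr comp_polyX.
by rewrite IH comp_polyA.
Qed.

Lemma horner_comp_seq_int (cs ts : seq _) (x : int) :
    {subset ts <= quadratic_set cs} ->
  exists y : int, (comp_seq ts).[x%:~R] = y%:~R.
Proof.
elim: ts => [|t ts IH] sub /=; first by exists x; rewrite hornerX.
have [y yE] : exists y : int, (comp_seq ts).[x%:~R] = y%:~R.
  by apply: IH => u uts; apply: sub; rewrite inE uts orbT.
have /mapP [c _ ->] : t \in quadratic_set cs by apply: sub; rewrite mem_head.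
by exists (quad c y); rewrite horner_comp yE -/(quad_poly c) horner_quad_poly.
Qed.

Lemma even_monic_irreducible_comp_seq g (cs ts : seq _) :
    even_monic_irreducible g -> (forall (y : int) w, g.[y%:~R] <> w ^+ 2) ->
    {subset ts <= quadratic_set cs} ->
  even_monic_irreducible (g \Po comp_seq ts).
Proof.
move=> gok gns; elim/last_ind: ts => [|ts t IH] sub; first by rewrite comp_polyXr.
have sub' : {subset ts <= quadratic_set cs}.
  by move=> u uts; apply: sub; rewrite mem_rcons inE uts orbT.
have /mapP [c _ ->] : t \in quadratic_set cs.
  by apply: sub; rewrite mem_rcons mem_head.
rewrite comp_seq_rcons comp_polyA; apply: even_monic_irreducible_comp.
  exact: IH.
have [y yE] := horner_comp_seq_int c sub'.
by move=> w; rewrite horner_comp yE; apply: gns.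
Qed.

Lemma irreducible_semigroup_coset (c d : int) (cs : seq int) (n : nat) :
    irreducible_poly (quad_poly c) -> ~ hits_square c d n.+1 ->
  forall F, in_comp_semigroup (quadratic_set cs) F ->
  irreducible_poly
    (comp_iter n.+1 (quad_poly c) \Po (quad_poly d \Po (quad_poly c \Po F))).
Proof.
move=> cirr nohit F [ts [_ sub ->]].
have nsq z : z = 0 \/ (exists y, z = quad c y) ->
    nonsquare (iter n.+1 (quad c) (quad d z)).
  by move=> zE w wE; apply: nohit; exists z, w.
have Gd : even_monic_irreducible (comp_iter n.+1 (quad_poly c) \Po quad_poly d).
  apply: even_monic_irreducible_comp; first exact: even_monic_irreducible_iter.
  move=> w; rewrite horner_comp_iter; apply: nonsquare_rat.
  by have := nsq 0 (or_introl erefl); rewrite {2}/quad expr0n add0r.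
have eval y : ((comp_iter n.+1 (quad_poly c) \Po quad_poly d) \Po quad_poly c).[y%:~R] =
    (iter n.+1 (quad c) (quad d (quad c y)))%:~R.
  by rewrite 2!horner_comp 2!horner_quad_poly horner_comp_iter.
have Gdc : even_monic_irreducible
    ((comp_iter n.+1 (quad_poly c) \Po quad_poly d) \Po quad_poly c).
  apply: even_monic_irreducible_comp Gd _ => w.
  rewrite horner_comp horner_quad_poly horner_comp_iter; apply: nonsquare_rat.
  by apply: nsq; right; exists 0; rewrite /quad expr0n add0r.
rewrite !comp_polyA.
have [] // := even_monic_irreducible_comp_seq Gdc _ sub.
by move=> y w; rewrite eval; apply/nonsquare_rat/nsq; right; exists y.
Qed.

Theorem theorem1p1 (s : nat) (c : s.-tuple int) (c_distinct : uniq c)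
  (two_irreducible : exists p q : {poly rat},
     [/\ p \in quadratic_set c, q \in quadratic_set c, p != q,
         irreducible_poly p & irreducible_poly q]) :
  exists (N : nat) (phi_i phi_j : {poly rat}),
    [/\ (2 <= N)%N, phi_i \in quadratic_set c, phi_j \in quadratic_set c &
        forall F : {poly rat}, in_comp_semigroup (quadratic_set c) F ->
          irreducible_poly
            (comp_iter N phi_i \Po (phi_j \Po (phi_i \Po F)))].
Proof.
have [p [q [pS qS pq pirr qirr]]] := two_irreducible.
have /mapP [a _ pE] := pS; have /mapP [b _ qE] := qS.
rewrite -/(quad_poly a) in pE; rewrite -/(quad_poly b) in qE; subst p q.
have ab : a != b by apply: contraNneq pq => ->.
have [[|k] [k2 nohit]] := exists_square_free_order
  (irreducible_quad_poly_nonsquare pirr) (irreducible_quad_poly_nonsquare qirr) ab.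
  by [].
case: nohit => nohit.
  exists k.+1.*2, (quad_poly a), (quad_poly b); split=> //.
  exact: irreducible_semigroup_coset.
exists k.+1.*2, (quad_poly b), (quad_poly a); split=> //.
exact: irreducible_semigroup_coset.
Qed.
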